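(* Consider the Beckmann model with BPR cost functions, let $t^*$ be a minimizer of $Q$ over $t\ge\bar t$ and $R=\|t^*-\bar t\|_2$. Let $\varepsilon>0$ and let the universal method of similar triangles (UMST) be run with accuracy $\varepsilon$ and initial parameter $0<L_0\le\frac{4M^2}{\varepsilon}$, producing $t^N,\hat f^N$. Then after at most $$N_Q=4\left(\frac{RM}{\varepsilon}\right)^2$$ iterations of UMST it holds that $Q(t^N)-Q(t^* )\le\varepsilon$. Moreover, the stopping criterion $$Q(t^N)+\Psi(\hat f^N)\le\varepsilon$$ is fulfilled after at most $$N_{stop}=4\left(\frac{\tilde RM}{\varepsilon}\right)^2$$ iterations, where $$\tilde R^2=\rho^2\sum_{e\in E}\frac{\bar t_e^2}{\bar f_e^{2/\mu}}\left(\sum_{w\in OD}d_w\right)^{2/\mu}.$$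
   Context: Network. $G=(V,E)$ is a finite directed graph. $OD$ is a finite set of origin-destination pairs $w=(i,j)$ of vertices, with demands $d_w\ge 0$. $P_w$ is the (nonempty) set of simple paths from $i$ to $j$ for $w=(i,j)$, and $P=\bigcup_{w\in OD}P_w$. $X=\{x\in\mathbb R_+^{|P|}:\sum_{p\in P_w}x_p=d_w,\ w\in OD\}$. $\Theta$ is the $|E|\times|P|$ matrix with $\Theta_{e,p}=1$ if $e\in p$ and $0$ otherwise. Each edge $e$ has free flow time $\bar t_e>0$ and capacity $\bar f_e>0$. For $t\in\mathbb R_+^{|E|}$: $T_p(t)=\sum_{e\in p}t_e$, $T_w(t)=\min_{p\in P_w}T_p(t)$. Vector inequalities are componentwise. Beckmann model. With parameters $\rho>0$, $\mu>0$, the cost functions are $\tau_e(f_e)=\bar t_e\bigl(1+\rho(f_e/\bar f_e)^{1/\mu}\bigr)$ for $f_e\ge0$. The primal objective is $\Psi(f)=\sum_{e\in E}\int_0^{f_e}\tau_e(z)\,dz$, to be minimized over $f\in\{\Theta x:x\in X\}$. The dual problem is to minimize over $t\ge\bar t$ the function $Q(t)=\Phi(t)+h(t)$, where $\Phi(t)=-\sum_{w\in OD}d_wT_w(t)$ and $h(t)=\sum_{e\in E}\bar f_e\left(\frac{t_e-\bar t_e}{\bar t_e\rho}\right)^{\mu}\frac{t_e-\bar t_e}{1+\mu}$ with $\operatorname{dom}h=\{t:t\ge\bar t\}$. Subgradients. $\partial\Phi(t)=-\sum_{w\in OD}d_w\,\mathrm{Conv}\{a_p:p\in P_w,\ T_p(t)=T_w(t)\}$,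 where $a_p\in\{0,1\}^{|E|}$ is the indicator vector of the edges of $p$. $\nabla\Phi(t)$ denotes an arbitrary (chosen) element of $\partial\Phi(t)$. Constant $M$. $M=\sqrt{2H}\sum_{w\in OD}d_w$, where $H$ is the diameter of $G$; $M$ comes with the bound $\|\nabla\Phi(t_1)-\nabla\Phi(t_2)\|_2\le M$ for all $t_1,t_2\in\mathbb R_+^{|E|}$ and all choices of subgradients. UMST. Input $L_0>0$, $\varepsilon>0$. Set $u^0=t^0=\bar t$, $A_0=0$, $\phi_0(t)=\frac12\|t-t^0\|_2^2$. For $k=0,1,2,\dots$: set $L_{k+1}:=L_k/2$; repeat: compute $$\alpha_{k+1}=\frac1{2L_{k+1}}+\sqrt{\frac1{4L_{k+1}^2}+\frac{A_k}{L_{k+1}}},\quad A_{k+1}=A_k+\alpha_{k+1},\quad y^{k+1}=\frac{\alpha_{k+1}u^k+A_kt^k}{A_{k+1}},$$ $$\phi_{k+1}(t)=\phi_k(t)+\alpha_{k+1}\left[\Phi(y^{k+1})+\langle\nabla\Phi(y^{k+1}),t-y^{k+1}\rangle+h(t)\right],$$ $$u^{k+1}=\arg\min_{t\in\operatorname{dom}h}\phi_{k+1}(t),\quad t^{k+1}=\frac{\alpha_{k+1}u^{k+1}+A_kt^k}{A_{k+1}};$$ if $\Phi(t^{k+1})\le\Phi(y^{k+1})+\langle\nabla\Phi(y^{k+1}),t^{k+1}-y^{k+1}\rangle+\frac{L_{k+1}}2\|t^{k+1}-y^{k+1}\|_2^2+\frac{\alpha_{k+1}}{2A_{k+1}}\varepsilon$,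 accept all these quantities and go to the next $k$; otherwise replace $L_{k+1}$ by $2L_{k+1}$ and repeat. ''Iterations'' counts the outer index $k$. After $N\ge1$ iterations, $\hat f^N=-\frac1{A_N}\sum_{k=1}^N\alpha_k\nabla\Phi(y^k)$. Convention: a property ''holds after at most $K$ iterations'' means that it holds for some integer $N$ with $1\le N\le\max\{1,\lceil K\rceil\}$. *)

(* Defs.v *)
From HB Require Import structures.
From mathcomp Require Import all_boot all_order all_algebra.
From mathcomp Require Import all_classical all_reals all_analysis.

Set Implicit Arguments.
Unset Strict Implicit.
Unset Printing Implicit Defensive.

Import Order.TTheory GRing.Theory Num.Theory.
Import numFieldNormedType.Exports.

Local Open Scope classical_set_scope.
Local Open Scope ring_scope.

Section Graph.
Variables (V : finType) (adj : rel V).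

Definition edge := {e : V * V | adj e.1 e.2}.

(* A path is the sequence of its vertices, both endpoints included. *)
Definition is_simple_path (w : V * V) (p : seq V) : bool :=
  if p is x :: q then
    [&& x == w.1, last x q == w.2, path adj x q & uniq p]
  else false.

(* A simple path has at most #|V| vertices, so bounded sequences lose nothing
   and make the set of simple paths finite. *)
Definition vpath := #|V|.-bseq V.

Definition simple_paths (w : V * V) : {set vpath} :=
  [set p : vpath | is_simple_path w p].

Definition on_path (e : edge) (p : vpath) : bool :=
  val e \in zip p (behead p).

(* Number of edges of a shortest path.  Shortest paths are simple, and a simple
   path has fewer than #|V| edges, so the neutral element #|V| is never
   attained when w.2 is reachable from w.1. *)
Definition distance (w : V * V) : nat :=
  \big[minn/#|V|]_(p in simple_paths w) (size p).-1.

(* Largest distance over the ordered pairs with w.2 reachable from w.1. *)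
Definition diameter : nat :=
  \max_(w : V * V | simple_paths w != finset.set0) distance w.

End Graph.

Section Euclidean.
Variables (R : realType) (E : finType).
Local Notation vec := {ffun E -> R}.

Definition lev (s t : vec) : Prop := forall e, s e <= t e.

Definition dotv (s t : vec) : R := \sum_e s e * t e.

Definition norm2 (t : vec) : R := Num.sqrt (\sum_e t e ^+ 2).

Definition conv_hull (A : set vec) : set vec :=
  [set v | exists (n : nat) (c : 'I_n -> R) (a : 'I_n -> vec),
    [/\ forall i, 0 <= c i, \sum_i c i = 1, forall i, A (a i)
      & v = \sum_i c i *: a i]].

Definition is_argmin (D : set vec) (f : vec -> R) (u : vec) : Prop :=
  D u /\ forall t, D t -> f u <= f t.

(* Minimum of a nonempty finite sequence; 0 for the empty one. *)
Definition min_seq (s : seq R) : R := \big[Num.min/head 0 s]_(x <- s) x.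

End Euclidean.

Record beckmann (R : realType) := Beckmann {
  vertex : finType;
  adj : rel vertex;
  od : {set vertex * vertex};
  demand : vertex * vertex -> R;
  free_time : {ffun edge adj -> R};
  capacity : {ffun edge adj -> R};
  rho : R;
  mu : R;
  od_connected : forall w, w \in od -> simple_paths adj w != finset.set0;
  demand_ge0 : forall w, w \in od -> 0 <= demand w;
  free_time_gt0 : forall e, 0 < free_time e;
  capacity_gt0 : forall e, 0 < capacity e;
  rho_gt0 : 0 < rho;
  mu_gt0 : 0 < mu
}.

Arguments adj {R} b.
Arguments demand {R} b.
Arguments free_time {R} b.
Arguments capacity {R} b.

Section Model.
Variables (R : realType) (B : beckmann R).

Definition evec := {ffun edge (adj B) -> R}.

Definition path_time (t : evec) (p : vpath (vertex B)) : R :=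
  \sum_(e : edge (adj B) | on_path e p) t e.

Definition od_time (t : evec) (w : vertex B * vertex B) : R :=
  min_seq [seq path_time t p | p <- enum (simple_paths (adj B) w)].

Definition cost (e : edge (adj B)) (z : R) : R :=
  free_time B e * (1 + rho B * (z / capacity B e) `^ (mu B)^-1).

Definition Psi (f : evec) : R :=
  \sum_e \int[lebesgue_measure]_(z in `[0, f e]) cost e z.

Definition Phi (t : evec) : R :=
  - \sum_(w in od B) demand B w * od_time t w.

Definition dom_h : set evec := [set t | lev (free_time B) t].

(* Only meaningful on dom_h. *)
Definition h (t : evec) : R :=
  \sum_e capacity B e
    * ((t e - free_time B e) / (free_time B e * rho B)) `^ mu B
    * ((t e - free_time B e) / (1 + mu B)).

Definition Q (t : evec) : R := Phi t + h t.

Definition path_indicator (p : vpath (vertex B)) : evec :=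
  [ffun e => (on_path e p)%:R].

Definition shortest_indicators (t : evec) (w : vertex B * vertex B)
    : set evec :=
  [set path_indicator p | p in
    [set p | p \in simple_paths (adj B) w /\ path_time t p = od_time t w]].

Definition subdiff_Phi (t : evec) : set evec :=
  [set g | exists a : vertex B * vertex B -> evec,
    (forall w, w \in od B -> conv_hull (shortest_indicators t w) (a w)) /\
    g = - \sum_(w in od B) demand B w *: a w].

Definition total_demand : R := \sum_(w in od B) demand B w.

Definition M : R :=
  Num.sqrt (2 * (diameter (adj B))%:R) * total_demand.

Definition Rtilde : R :=
  Num.sqrt (rho B ^+ 2
    * (\sum_e free_time B e ^+ 2 / capacity B e `^ (2 / mu B))
    * total_demand `^ (2 / mu B)).

End Model.

Section UMST.
Variables (R : realType) (B : beckmann R).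
Variables (grad : evec B -> evec B) (L0 eps : R).

(* The quantities carrying index k in the method. *)
Record umst_state := UmstState {
  st_L : R;
  st_alpha : R;
  st_A : R;
  st_y : evec B;
  st_u : evec B;
  st_t : evec B;
  st_phi : evec B -> R
}.

(* There is no alpha_0 and no y^0: these two fields are left free. *)
Definition umst_init (s : umst_state) : Prop :=
  [/\ st_L s = L0, st_A s = 0, st_u s = free_time B, st_t s = free_time B
    & st_phi s = fun t => 2^-1 * norm2 (t - free_time B) ^+ 2].

Definition linearization (y t : evec B) : R :=
  Phi y + dotv (grad y) (t - y).

(* One pass through the body of the inner loop, from the accepted quantities s
   of index k and the trial value L of L_(k+1). *)
Definition umst_trial (s : umst_state) (L : R) (s' : umst_state) : Prop :=
  [/\ st_L s' = L,
      st_alpha s' =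
        (2 * L)^-1 + Num.sqrt ((4 * L ^+ 2)^-1 + st_A s / L)
      & st_A s' = st_A s + st_alpha s'] /\
  [/\ st_y s' =
        (st_A s')^-1 *: (st_alpha s' *: st_u s + st_A s *: st_t s),
      st_phi s' =
        (fun t => st_phi s t
                  + st_alpha s' * (linearization (st_y s') t + h t)),
      is_argmin (@dom_h R B) (st_phi s') (st_u s')
      & st_t s' =
        (st_A s')^-1 *: (st_alpha s' *: st_u s' + st_A s *: st_t s)].

Definition umst_accept (s' : umst_state) : Prop :=
  Phi (st_t s') <=
    linearization (st_y s') (st_t s')
    + st_L s' / 2 * norm2 (st_t s' - st_y s') ^+ 2
    + st_alpha s' / (2 * st_A s') * eps.

(* [umst_search s L s']: the inner loop entered with trial value L terminates
   and accepts s'. *)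
Inductive umst_search (s : umst_state) : R -> umst_state -> Prop :=
| UmstAccept L s' :
    umst_trial s L s' -> umst_accept s' -> umst_search s L s'
| UmstRetry L s' s'' :
    umst_trial s L s' -> ~ umst_accept s' ->
    umst_search s (2 * L) s'' -> umst_search s L s''.

Definition umst_run (s : nat -> umst_state) : Prop :=
  umst_init (s 0%N) /\
  forall k, umst_search (s k) (st_L (s k) / 2) (s k.+1).

Definition fhat (s : nat -> umst_state) (N : nat) : evec B :=
  - ((st_A (s N))^-1
     *: \sum_(1 <= k < N.+1) st_alpha (s k) *: grad (st_y (s k))).

End UMST.

Definition holds_within (R : realType) (K : R) (P : nat -> Prop) : Prop :=
  exists N : nat,
    [/\ (1 <= N)%N, (N%:Z <= Num.max 1 (Num.ceil K))%R & P N].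

(* Main.v *)
Require Import Defs.
From HB Require Import structures.
From mathcomp Require Import all_boot all_order all_algebra.
From mathcomp Require Import all_classical all_reals all_analysis.
From mathcomp Require Import ring lra.

Import Order.TTheory GRing.Theory Num.Theory.
Import numFieldNormedType.Exports.

Local Open Scope ring_scope.

(** Since [Phi] is a support function, a subgradient [g] at [y] satisfies
    [<g, y> = Phi y] and [<g, t> <= Phi t] for all [t]; hence the linearization of
    [Phi] at [y] is the linear form [<g, .>].  The estimate functions are thus
    [phi_k t = |t - tbar|^2 / 2 + <G_k, t> + A_k h t] with
    [G_k = \sum_j alpha_j g_j = - A_k fhat^k].
    They are 1-strongly convex, and [A_k = L_k alpha_k^2] makes the accepted
    quadratic term exactly cancel the strong convexity gain, so by induction
    [A_k Q(t^k) <= min phi_k + A_k eps / 2].  Bounding the minimum by the value at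
    [t*] yields the first claim; bounding it by the value at the edge costs
    [tau(fhat)], where [<fhat, tau> - h tau = Psi fhat] and
    [|tau - tbar| <= Rtilde], yields the second one.
    A trial is accepted as soon as [alpha M^2 <= eps]; as doubling [L] at most
    halves [alpha], the bound on [L0] gives [alpha >= eps / (2 M^2)] at every
    accepted step, whence [A_N >= N eps / (2 M^2)]. *)

(** * Inner products and squared norms of edge vectors *)

Lemma sqr_norm2 (R : realType) (E : finType) (t : {ffun E -> R}) :
  norm2 t ^+ 2 = \sum_e t e ^+ 2.
Proof. by rewrite sqr_sqrtr// sumr_ge0// => e _; rewrite sqr_ge0. Qed.

Lemma sqr_norm2Z (R : realType) (E : finType) (a : R) (t : {ffun E -> R}) :
  norm2 (a *: t) ^+ 2 = a ^+ 2 * norm2 t ^+ 2.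
Proof.
rewrite !sqr_norm2 mulr_sumr; apply: eq_bigr => e _.
by rewrite ffunE exprMn.
Qed.

Lemma dotvDr (R : realType) (E : finType) (g s t : {ffun E -> R}) :
  dotv g (s + t) = dotv g s + dotv g t.
Proof. by rewrite -big_split; apply: eq_bigr => e _; rewrite ffunE mulrDr. Qed.

Lemma dotvZr (R : realType) (E : finType) (g t : {ffun E -> R}) (a : R) :
  dotv g (a *: t) = a * dotv g t.
Proof.
by rewrite mulr_sumr; apply: eq_bigr => e _; rewrite ffunE mulrCA.
Qed.

Lemma dotvC (R : realType) (E : finType) (s t : {ffun E -> R}) :
  dotv s t = dotv t s.
Proof. by apply: eq_bigr => e _; rewrite mulrC. Qed.

Lemma dotvDl (R : realType) (E : finType) (g s t : {ffun E -> R}) :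
  dotv (s + t) g = dotv s g + dotv t g.
Proof. by rewrite !(dotvC _ _ _ g) dotvDr. Qed.

Lemma dotvZl (R : realType) (E : finType) (g t : {ffun E -> R}) (a : R) :
  dotv (a *: t) g = a * dotv t g.
Proof. by rewrite !(dotvC _ _ _ g) dotvZr. Qed.

Lemma dotvBr (R : realType) (E : finType) (g s t : {ffun E -> R}) :
  dotv g (s - t) = dotv g s - dotv g t.
Proof. by rewrite -scaleN1r dotvDr dotvZr mulN1r. Qed.

Lemma dotvBl (R : realType) (E : finType) (g s t : {ffun E -> R}) :
  dotv (s - t) g = dotv s g - dotv t g.
Proof. by rewrite !(dotvC _ _ _ g) dotvBr. Qed.

Lemma dotv_suml (R : realType) (E : finType) (I : Type) (r : seq I)
    (P : pred I) (F : I -> {ffun E -> R}) (t : {ffun E -> R}) :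
  dotv (\sum_(i <- r | P i) F i) t = \sum_(i <- r | P i) dotv (F i) t.
Proof.
elim/big_rec2: _ => [|i a v _ <-]; last by rewrite dotvDl.
by rewrite /dotv big1// => e _; rewrite ffunE mul0r.
Qed.

Lemma dotv_young (R : realType) (E : finType) (g d : {ffun E -> R}) (L : R) :
  0 < L -> dotv g d <= (2 * L)^-1 * norm2 g ^+ 2 + L / 2 * norm2 d ^+ 2.
Proof.
move=> L0; rewrite !sqr_norm2 !mulr_sumr -big_split; apply: ler_sum => e _ /=.
rewrite -subr_ge0.
have -> : (2 * L)^-1 * g e ^+ 2 + L / 2 * d e ^+ 2 - g e * d e
    = (2 * L)^-1 * (g e - L * d e) ^+ 2.
  by field; rewrite gt_eqF.
by rewrite mulr_ge0 ?sqr_ge0// invr_ge0; lra.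
Qed.

(** The last term is the source of the strong convexity of the estimate functions. *)
Lemma sqr_norm2_conv (R : realType) (E : finType) (s t : {ffun E -> R}) (l : R) :
  norm2 ((1 - l) *: s + l *: t) ^+ 2 =
  (1 - l) * norm2 s ^+ 2 + l * norm2 t ^+ 2 - l * (1 - l) * norm2 (t - s) ^+ 2.
Proof.
rewrite !sqr_norm2 !mulr_sumr -big_split -sumrB; apply: eq_bigr => e _ /=.
by rewrite !ffunE /GRing.scale/=; ring.
Qed.

(** * Powers with a real exponent *)

(* Without the norm this fails at 0, since [x `^ p = 1] for [x < 0]. *)
Lemma continuous_norm_powR (R : realType) (p : R) :
  0 < p -> continuous (fun x : R => `|x| `^ p).
Proof.
move=> p0 x; have [->|x0] := eqVneq x 0.
  apply/cvgrPdist_lt => e e0.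
  near=> y; rewrite /= normr0 powR0 ?gt_eqF// sub0r normrN ger0_norm ?powR_ge0//.
  rewrite -[e]powRr1 ?ltW// -(mulVf (lt0r_neq0 p0)) powRrM.
  rewrite gt0_ltr_powR ?nnegrE ?powR_ge0//.
  by near: y; apply: cvgr0_norm_lt => //; exact: powR_gt0.
have nx0 : 0 < `|x| by rewrite normr_gt0.
apply: (@continuous_comp _ _ _ (fun y : R => `|y|) (fun y : R => y `^ p)).
  exact: norm_continuous.
apply: differentiable_continuous; apply/derivable1_diffP.
by apply: derivable_powR; rewrite in_itv/= nx0.
Unshelve. all: by end_near. Qed.

(** One coordinate of the problem defining [u^{k+1}]. Compactness gives a minimum on [[0, 2 * |g|]];
    beyond it the quadratic term outweighs [g * y], so the value is at least that at 0. *)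
Lemma quadratic_powR_min (R : realType) (g C p : R) : 0 <= C -> 0 < p ->
  exists2 x, 0 <= x & forall y, 0 <= y ->
    2^-1 * x ^+ 2 + g * x + C * x `^ p <= 2^-1 * y ^+ 2 + g * y + C * y `^ p.
Proof.
move=> C0 p0; pose f (x : R) := 2^-1 * x ^+ 2 + g * x + C * `|x| `^ p.
have cf : continuous f.
  move=> x; apply: cvgD; last by apply: cvgMr; exact: continuous_norm_powR.
  by apply: cvgD; apply: cvgMr; [exact: exprn_continuous|exact: cvg_id].
pose b : R := 2 * `|g|.
have b0 : 0 <= b by rewrite mulr_ge0.
have [x] := EVT_min b0 (continuous_subspaceT cf).
rewrite in_itv/= => /andP[x0 xb] xmin; exists x => // y y0.
have [yb|/ltW by_] := leP y b.
  by have := xmin y; rewrite in_itv/= y0 yb /f !ger0_norm//; apply.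
have := xmin 0; rewrite in_itv/= lexx b0 /f (ger0_norm x0) => /(_ isT) /le_trans.
apply; rewrite normr0 powR0 ?gt_eqF//.
have gy : - g * y <= `|g| * y by rewrite ler_wpM2r// -normrN ler_norm.
have : 2 * `|g| * y <= y * y by rewrite ler_wpM2r.
have : 0 <= C * y `^ p by rewrite mulr_ge0// powR_ge0.
by rewrite !expr2; lra.
Qed.

Lemma powR_convex (R : realType) (p l x y : R) :
  1 <= p -> 0 <= l <= 1 -> 0 <= x -> 0 <= y ->
  ((1 - l) * x + l * y) `^ p <= (1 - l) * x `^ p + l * y `^ p.
Proof.
move=> p1 /andP[l0 l1] x0 y0.
have := convex_powR p1 (Itv01 l0 l1) (x := y) (y := x).
rewrite !inE /= !in_itv/= x0 y0 => /(_ isT isT).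
rewrite convRE [X in X `^ _ <= _ -> _]convRE /=.
by rewrite [l * y + _]addrC [l * y `^ p + _]addrC.
Qed.

Lemma min_seq_le (R : realType) (s : seq R) (x : R) : x \in s -> min_seq s <= x.
Proof.
rewrite /min_seq; move: (head 0 s) => x0; elim: s => //= a s IHs.
rewrite inE big_cons => /predU1P[->|/IHs]; first by rewrite ge_min lexx.
by move=> le_x; rewrite ge_min le_x orbT.
Qed.

(** * Subgradients of [Phi], convexity of [h], estimate functions *)

Section Potential.
Variables (R : realType) (B : beckmann R).
Implicit Types (t y g : evec B) (w : vertex B * vertex B).

Lemma dotv_path_indicator p t : dotv (path_indicator p) t = path_time t p.
Proof.
rewrite /dotv /path_time [RHS]big_mkcond; apply: eq_bigr => e _.
by rewrite ffunE; case: ifP; rewrite ?mul1r ?mul0r.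
Qed.

(** Each fact holds for the indicator of a path that is shortest at [y] and survives convex
    combinations. *)
Lemma conv_hull_shortest y w g : conv_hull (shortest_indicators y w) g ->
  [/\ dotv g y = od_time y w, forall t, od_time t w <= dotv g t
    & forall e, 0 <= g e <= 1].
Proof.
move=> [n [c [a [c0 c1 sa ->]]]].
have dotE t : dotv (\sum_i c i *: a i) t = \sum_i c i * dotv (a i) t.
  by rewrite dotv_suml; apply: eq_bigr => i _; rewrite dotvZl.
split=> [|t|e].
- rewrite dotE -[RHS]mul1r -c1 mulr_suml; apply: eq_bigr => i _.
  by have [p [_ pE] <-] := sa i; rewrite dotv_path_indicator pE.
- rewrite dotE -[leLHS]mul1r -c1 mulr_suml; apply: ler_sum => i _.
  rewrite ler_wpM2l//; have [p [pw _] <-] := sa i; rewrite dotv_path_indicator.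
  by apply: min_seq_le; apply: map_f; rewrite mem_enum.
- have a01 i : 0 <= a i e <= 1.
    by have [p _ <-] := sa i; rewrite ffunE ler0n lern1 leq_b1.
  rewrite sum_ffunE; apply/andP; split.
    by apply: sumr_ge0 => i _; rewrite ffunE mulr_ge0//; have /andP[] := a01 i.
  rewrite -c1; apply: ler_sum => i _; rewrite ffunE.
  by rewrite ler_piMr//; have /andP[] := a01 i.
Qed.

Lemma subdiff_Phi_homog y g : subdiff_Phi y g -> dotv g y = Phi y.
Proof.
move=> [a [ha ->]]; rewrite -scaleN1r dotvZl mulN1r dotv_suml; congr (- _).
apply: eq_bigr => w wod; rewrite dotvZl.
by have [-> _ _] := conv_hull_shortest _ _ _ (ha w wod).
Qed.

Lemma subdiff_Phi_le y g t : subdiff_Phi y g -> dotv g t <= Phi t.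
Proof.
move=> [a [ha ->]]; rewrite -scaleN1r dotvZl mulN1r dotv_suml lerN2.
apply: ler_sum => w wod; rewrite dotvZl ler_wpM2l ?demand_ge0//.
by have [_ + _] := conv_hull_shortest _ _ _ (ha w wod); apply.
Qed.

Lemma subdiff_Phi_flow y g e :
  subdiff_Phi y g -> 0 <= - g e <= total_demand B.
Proof.
move=> [a [ha ->]]; rewrite ffunE opprK sum_ffunE; apply/andP; split.
  apply: sumr_ge0 => w wod; rewrite ffunE mulr_ge0 ?demand_ge0//.
  by have [_ _ /(_ e)/andP[]] := conv_hull_shortest _ _ _ (ha w wod).
apply: ler_sum => w wod; rewrite ffunE ler_piMr ?demand_ge0//.
by have [_ _ /(_ e)/andP[]] := conv_hull_shortest _ _ _ (ha w wod).
Qed.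

(** Merging the two factors of [h] that involve [t e] leaves a single power of exponent [1 + mu],
    which is convex; this is its coefficient. *)
Definition h_coef (e : edge (adj B)) : R :=
  capacity B e / ((free_time B e * rho B) `^ mu B * (1 + mu B)).

Lemma h_coef_ge0 e : 0 <= h_coef e.
Proof.
rewrite divr_ge0 ?ltW ?capacity_gt0// mulr_gt0 ?powR_gt0 ?mulr_gt0//.
- exact: free_time_gt0.
- exact: rho_gt0.
- by rewrite addr_gt0 ?mu_gt0.
Qed.

(* Off [dom_h] the two sides differ: [x `^ p = 1] for [x < 0]. *)
Lemma h_powR t : dom_h t ->
  h t = \sum_e h_coef e * (t e - free_time B e) `^ (1 + mu B).
Proof.
move=> tdom; apply: eq_bigr => e _.
have x0 : 0 <= t e - free_time B e by rewrite subr_ge0; exact: tdom.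
have tr0 : 0 < free_time B e * rho B by rewrite mulr_gt0 ?free_time_gt0 ?rho_gt0.
have m0 := mu_gt0 B; rewrite powRM ?invr_ge0 ?(ltW tr0)//.
have -> : (t e - free_time B e) `^ (1 + mu B) =
    (t e - free_time B e) * (t e - free_time B e) `^ mu B.
  rewrite powRD ?powRr1//; apply/implyP; lra.
have -> : (free_time B e * rho B)^-1 `^ mu B = ((free_time B e * rho B) `^ mu B)^-1.
  by rewrite -powR_inv1 ?(ltW tr0)// -powRrM mulN1r powRN.
rewrite /h_coef; field.
by rewrite !lt0r_neq0 ?powR_gt0 ?addr_gt0.
Qed.

Lemma dom_h_conv (s t : evec B) (a b : R) : 0 <= a -> 0 <= b -> a + b = 1 ->
  dom_h s -> dom_h t -> dom_h (a *: s + b *: t).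
Proof.
move=> a0 b0 ab sd td e; rewrite !ffunE -[leLHS]mul1r -ab mulrDl.
by apply: lerD; rewrite ler_wpM2l.
Qed.

Lemma dom_h_ge0 t : dom_h t -> lev 0 t.
Proof. by move=> td e; rewrite ffunE (le_trans (ltW (free_time_gt0 e)) (td e)). Qed.

Lemma h_convex (s t : evec B) (l : R) : 0 <= l <= 1 -> dom_h s -> dom_h t ->
  h ((1 - l) *: s + l *: t) <= (1 - l) * h s + l * h t.
Proof.
move=> /[dup] l01 /andP[l0 l1] sd td.
have vd : dom_h ((1 - l) *: s + l *: t) by apply: dom_h_conv => //; lra.
rewrite !h_powR// !mulr_sumr -big_split; apply: ler_sum => e _ /=.
have factor (c a b : R) :
    (1 - l) * (c * a) + l * (c * b) = c * ((1 - l) * a + l * b) by ring.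
rewrite factor ler_wpM2l ?h_coef_ge0//.
have -> : ((1 - l) *: s + l *: t) e - free_time B e =
   (1 - l) * (s e - free_time B e) + l * (t e - free_time B e).
  by rewrite !ffunE /GRing.scale/=; ring.
by apply: powR_convex; rewrite ?subr_ge0//; have := mu_gt0 B; lra.
Qed.

(* [phi_k], with the linearizations aggregated into the linear form [G]. *)
Definition model (G : evec B) (A : R) (t : evec B) : R :=
  2^-1 * norm2 (t - free_time B) ^+ 2 + dotv G t + A * h t.

(** On [dom_h] the model separates into functions of the single excesses [t e - free_time B e], so
    it is minimized edge by edge. *)
Lemma model_argmin (G : evec B) (A : R) :
  0 <= A -> exists u, is_argmin (@dom_h R B) (model G A) u.
Proof.
move=> A0; have p0 : 0 < 1 + mu B by rewrite addr_gt0 ?mu_gt0.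
have /choice[x xP] : forall e, exists x : R, 0 <= x /\ forall z, 0 <= z ->
    2^-1 * x ^+ 2 + G e * x + A * h_coef e * x `^ (1 + mu B) <=
    2^-1 * z ^+ 2 + G e * z + A * h_coef e * z `^ (1 + mu B).
  move=> e.
  have [x x0 xP] := quadratic_powR_min _ (G e) _ _ (mulr_ge0 A0 (h_coef_ge0 e)) p0.
  by exists x.
have modelE t : dom_h t -> model G A t = dotv G (free_time B) + \sum_e
   (2^-1 * (t e - free_time B e) ^+ 2 + G e * (t e - free_time B e)
    + A * h_coef e * (t e - free_time B e) `^ (1 + mu B)).
  move=> td; rewrite /model h_powR// sqr_norm2 !mulr_sumr /dotv -!big_split /=.
  by apply: eq_bigr => e _; rewrite !ffunE; ring.
have ud : dom_h (free_time B + [ffun e => x e]).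
  by move=> e; rewrite !ffunE lerDl; case: (xP e).
exists (free_time B + [ffun e => x e]); split=> // t td.
rewrite !modelE// lerD2l; apply: ler_sum => e _.
rewrite !ffunE [_ + x e]addrC addrK; case: (xP e) => _; apply.
by rewrite subr_ge0; exact: td.
Qed.

(** Compare [u] with the point a fraction [l] of the way to [t]: strong convexity bounds the model
    there, minimality of [u] bounds it below, and dividing by [l] gives [key]. *)
Lemma model_growth (G : evec B) (A : R) (u t : evec B) : 0 <= A ->
  is_argmin (@dom_h R B) (model G A) u -> dom_h t ->
  model G A u + 2^-1 * norm2 (t - u) ^+ 2 <= model G A t.
Proof.
move=> A0 [ud umin] td; set D := norm2 (t - u) ^+ 2.
have key l : 0 < l < 1 -> (1 - l) / 2 * D <= model G A t - model G A u.
  move=> /andP[l0 l1]; have l01 : 0 <= l <= 1 by lra.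
  have vd : dom_h ((1 - l) *: u + l *: t) by apply: dom_h_conv => //; lra.
  have := umin _ vd; rewrite /model dotvDr !dotvZr.
  have -> : (1 - l) *: u + l *: t - free_time B =
      (1 - l) *: (u - free_time B) + l *: (t - free_time B).
    by apply/ffunP => e; rewrite !ffunE /GRing.scale/=; ring.
  have tuE : t - free_time B - (u - free_time B) = t - u.
    by apply/ffunP => e; rewrite !ffunE; ring.
  rewrite sqr_norm2_conv tuE -/D => le_uv.
  have h_uv := ler_wpM2l A0 (h_convex _ _ _ l01 ud td).
  by rewrite -(ler_pM2l l0) /model; move: le_uv h_uv; lra.
have D0 : 0 <= D by rewrite sqr_ge0.
(* Letting [l] tend to 0 in [key]; an explicit small [l] suffices. *)
rewrite leNgt; apply/negP => lt_tu.
have ut := umin _ td.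
have Dp : 0 < D by lra.
(* With [gap = model t - model u], [key] is violated for all [l] below [1 - 2 * gap / D]; this is
   half that threshold. *)
have := key ((D / 2 - (model G A t - model G A u)) / D).
have -> : (1 - (D / 2 - (model G A t - model G A u)) / D) / 2 * D =
   D / 4 + (model G A t - model G A u) / 2 by field; rewrite gt_eqF.
have -> : 0 < (D / 2 - (model G A t - model G A u)) / D < 1.
  by rewrite ltr_pdivlMr// ltr_pdivrMr//; lra.
by move=> /(_ isT); lra.
Qed.

End Potential.

Arguments model {R B} G A t.

(** * [Psi] as the conjugate of [h] *)

Lemma Rintegral_affine_powR (R : realType) (a k q b : R) : 0 < q -> 0 <= b ->
  \int[lebesgue_measure]_(z in `[0, b]%classic) (a + k * z `^ q) =
  a * b + k / (q + 1) * b `^ (q + 1).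
Proof.
move=> q0 b0; have q10 : 0 < q + 1 by rewrite addr_gt0.
have [->|bN0] := eqVneq b 0.
  by rewrite set_itv1 Rintegral_set1 powR0 ?gt_eqF// !mulr0 addr0.
have {bN0} b0 : 0 < b by rewrite lt_def bN0.
pose F (z : R) := a * z + k / (q + 1) * z `^ (q + 1).
have dF (z : R) : 0 < z -> is_derive z 1 F (a + k * z `^ q).
  move=> z0; have dp := is_derive1_powR (q + 1) z0.
  have -> : a + k * z `^ q =
      a *: 1 + (k / (q + 1)) *: ((q + 1) * z `^ (q + 1 - 1)).
    by rewrite addrK /GRing.scale/=; field; rewrite gt_eqF.
  exact: is_deriveD.
have F0 : F 0 = 0 by rewrite /F powR0 ?gt_eqF// !mulr0 addr0.
rewrite /Rintegral (@continuous_FTC2 _ _ F) //.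
- by rewrite -EFinB/= F0 subr0.
(* The norm changes nothing on [[0, b]] and makes the integrand continuous on the whole line. *)
- apply: (@subspace_eq_continuous _ _ _ (fun z => a + k * `|z| `^ q)).
    by move=> z; rewrite inE/= in_itv/= => /andP[z0 _]; rewrite ger0_norm.
  apply: continuous_subspaceT => z; apply: cvgD; first exact: cvg_cst.
  by apply: cvgMr; exact: continuous_norm_powR.
- split.
  + by move=> z; rewrite in_itv/= => /andP[z0 _]; have [] := dF z z0.
  + have contG : continuous (fun z : R => a * z + k / (q + 1) * `|z| `^ (q + 1)).
      move=> z; apply: cvgD; apply: cvgMr; first exact: cvg_id.
      exact: continuous_norm_powR.
    have := cvg_at_right_filter (contG 0).
    rewrite normr0 powR0 ?gt_eqF// !mulr0 addr0 F0 => contG0.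
    apply: cvg_trans contG0; apply: near_eq_cvg; near=> z.
    by rewrite /F ger0_norm.
  + apply: cvg_at_left_filter; apply: differentiable_continuous.
    by apply/derivable1_diffP; have [] := dF b b0.
- move=> z; rewrite in_itv/= => /andP[z0 _].
  by rewrite derive1E; have dz := dF z z0; rewrite derive_val.
Unshelve. all: by end_near. Qed.

Section Conjugate.
Variables (R : realType) (B : beckmann R).
Implicit Types (f t : evec B).

(** For [f >= 0] this is the point where the gradient of [h] equals [f], so it attains the supremum
    of [<f, t> - h t] over [dom_h]. *)
Definition edge_costs f : evec B := [ffun e => cost e (f e)].

Lemma dom_h_edge_costs f : dom_h (edge_costs f).
Proof.
move=> e; rewrite ffunE /cost mulrDr mulr1 lerDl.
by rewrite !mulr_ge0 ?powR_ge0// ltW ?free_time_gt0 ?rho_gt0.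
Qed.

Lemma edge_costs_excess f e : edge_costs f e - free_time B e =
  free_time B e * rho B * (f e / capacity B e) `^ (mu B)^-1.
Proof. by rewrite ffunE /cost; ring. Qed.

(** The equality case of Fenchel's inequality: after integration both sides are, on each edge, the
    same combination of [f e] and its power of exponent [1 / mu + 1]. *)
Lemma Psi_conjugate f : (forall e, 0 <= f e) ->
  Psi f = dotv f (edge_costs f) - h (edge_costs f).
Proof.
move=> f0; rewrite /Psi /dotv /h -sumrB; apply: eq_bigr => e _.
have m0 := mu_gt0 B; have c0 := capacity_gt0 e; have t0 := free_time_gt0 e.
have r0 := rho_gt0 B; have q0 : 0 < (mu B)^-1 by rewrite invr_gt0.
have x0 : 0 <= f e / capacity B e by rewrite divr_ge0// ltW.
have pow1 (x : R) : 0 <= x -> x `^ ((mu B)^-1 + 1) = x `^ (mu B)^-1 * x.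
  by move=> ?; rewrite powRD ?powRr1//; apply/implyP; lra.
rewrite edge_costs_excess.
have -> : free_time B e * rho B * (f e / capacity B e) `^ (mu B)^-1
    / (free_time B e * rho B) = (f e / capacity B e) `^ (mu B)^-1.
  by field; rewrite !gt_eqF.
rewrite -powRrM mulVf ?gt_eqF// powRr1// ffunE.
pose k := free_time B e * rho B * (capacity B e)^-1 `^ (mu B)^-1.
have costE z : 0 <= z -> cost e z = free_time B e + k * z `^ (mu B)^-1.
  by move=> z0; rewrite /cost powRM ?invr_ge0 ?(ltW c0)// /k; ring.
have -> : \int[lebesgue_measure]_(z in `[0, f e]%classic) cost e z =
    \int[lebesgue_measure]_(z in `[0, f e]%classic)
      (free_time B e + k * z `^ (mu B)^-1).
  by apply: eq_Rintegral => z; rewrite inE/= in_itv/= => /andP[z0 _]; exact: costE.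
rewrite Rintegral_affine_powR// pow1// costE//.
rewrite [(f e / _) `^ _]powRM ?invr_ge0 ?(ltW c0)// /k; field.
by rewrite !lt0r_neq0// addr_gt0.
Qed.

Lemma total_demand_ge0 : 0 <= total_demand B.
Proof. by apply: sumr_ge0 => w wod; exact: demand_ge0. Qed.

(** The excess cost increases with the flow, and [Rtilde] is the norm of the excess when every edge
    carries the total demand. *)
Lemma edge_costs_le_Rtilde f : (forall e, 0 <= f e <= total_demand B) ->
  norm2 (edge_costs f - free_time B) ^+ 2 <= Rtilde B ^+ 2.
Proof.
move=> fD; have D0 := total_demand_ge0.
rewrite sqr_norm2 /Rtilde sqr_sqrtr; last first.
  apply: mulr_ge0; last exact: powR_ge0.
  rewrite mulr_ge0 ?sqr_ge0//; apply: sumr_ge0 => e _.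
  by rewrite divr_ge0 ?sqr_ge0 ?powR_ge0.
rewrite mulr_sumr mulr_suml; apply: ler_sum => e _.
have /andP[f0 fle] := fD e; have c0 := capacity_gt0 e.
have m0 := mu_gt0 B.
have sqr_powR (x : R) : (x `^ (mu B)^-1) ^+ 2 = x `^ (2 / mu B).
  by rewrite -powR_mulrn ?powR_ge0// -powRrM mulrC.
have -> : (edge_costs f - free_time B) e =
    edge_costs f e - free_time B e by rewrite !ffunE.
rewrite edge_costs_excess !exprMn sqr_powR powRM ?invr_ge0 ?(ltW c0)//.
have -> : (capacity B e)^-1 `^ (2 / mu B) = (capacity B e `^ (2 / mu B))^-1.
  by rewrite -powR_inv1 ?(ltW c0)// -powRrM mulN1r powRN.
have -> : free_time B e ^+ 2 * rho B ^+ 2 *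
    (f e `^ (2 / mu B) / capacity B e `^ (2 / mu B)) =
  rho B ^+ 2 * (free_time B e ^+ 2 / capacity B e `^ (2 / mu B))
    * f e `^ (2 / mu B) by ring.
rewrite ler_wpM2l//.
  by rewrite mulr_ge0 ?sqr_ge0// divr_ge0 ?sqr_ge0// powR_ge0.
by rewrite ge0_ler_powR ?nnegrE// divr_ge0// ltW.
Qed.

End Conjugate.

(** * The step size as a function of [L] and [A] *)

Section StepSize.
Variable R : realType.
Implicit Types L A c : R.

(** For [L > 0] and [A >= 0], the positive root [a] of [L * a ^+ 2 = A + a]. *)
Definition stepsize L A : R :=
  (2 * L)^-1 + Num.sqrt ((4 * L ^+ 2)^-1 + A / L).

Lemma stepsize_gt0 L A : 0 < L -> 0 < stepsize L A.
Proof. by move=> L0; rewrite ltr_pwDl ?sqrtr_ge0// invr_gt0 mulr_gt0. Qed.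

Lemma stepsize_eq L A :
  0 < L -> 0 <= A -> L * stepsize L A ^+ 2 = A + stepsize L A.
Proof.
move=> L0 A0; rewrite /stepsize; set q := Num.sqrt _.
have q2 : q ^+ 2 = (4 * L ^+ 2)^-1 + A / L.
  rewrite sqr_sqrtr// addr_ge0 ?(divr_ge0 A0 (ltW L0))// invr_ge0.
  by rewrite mulr_ge0 ?sqr_ge0.
have -> : L * ((2 * L)^-1 + q) ^+ 2 = (4 * L)^-1 + q + L * q ^+ 2.
  by field; rewrite gt_eqF.
by rewrite q2; field; rewrite gt_eqF.
Qed.

(** The quadratic [L * c ^+ 2 - c - A] is negative between 0 and its positive root. *)
Lemma stepsize_le L A c :
  0 < L -> 0 <= A -> 0 < c -> A + c <= L * c ^+ 2 -> stepsize L A <= c.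
Proof.
move=> L0 A0 c0 hc; rewrite leNgt; apply/negP => c_lt.
have := stepsize_eq L A L0 A0; set a := stepsize L A in c_lt * => aE.
have a0 : 0 < a := lt_trans c0 c_lt.
(* By [aE] this product equals [a * (A + c - L * c ^+ 2)], which [hc] makes nonpositive. *)
have pos : 0 < (a - c) * (L * a * c + A).
  by rewrite mulr_gt0 ?subr_gt0// ltr_wpDr// !mulr_gt0.
have := ler_wpM2l (ltW a0) hc; have := congr1 ( *%R c) aE; lra.
Qed.

Lemma stepsize_mono L L' A A' : 0 < L' -> L' <= L -> 0 <= A -> A <= A' ->
  stepsize L A <= stepsize L' A'.
Proof.
move=> L'0 leL A0 leA; have L0 := lt_le_trans L'0 leL.
have A'0 := le_trans A0 leA; have c0 := stepsize_gt0 L' A' L'0.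
apply: stepsize_le => //; have := stepsize_eq L' A' L'0 A'0; nra.
Qed.

(** For [b = stepsize (2 * L) A], [L * (2 * b) ^+ 2 = 2 * A + 2 * b], which is at least
    [A + 2 * b]. *)
Lemma stepsize_double L A :
  0 < L -> 0 <= A -> stepsize L A <= 2 * stepsize (2 * L) A.
Proof.
move=> L0 A0; have L20 : 0 < 2 * L by rewrite mulr_gt0.
have c0 := stepsize_gt0 (2 * L) A L20.
apply: stepsize_le; rewrite ?mulr_gt0//.
have := stepsize_eq (2 * L) A L20 A0; nra.
Qed.

End StepSize.

Arguments stepsize {R} L A.

(** * One iteration: the invariant, acceptance, termination of the search *)

Section Method.
Variables (R : realType) (B : beckmann R) (grad : evec B -> evec B).
Hypothesis grad_subdiff : forall t, lev 0 t -> subdiff_Phi t (grad t).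
Hypothesis M_bound : forall t1 t2 g1 g2 : evec B, lev 0 t1 -> lev 0 t2 ->
  subdiff_Phi t1 g1 -> subdiff_Phi t2 g2 -> norm2 (g1 - g2) <= M B.
Variable eps : R.
Hypothesis eps_gt0 : 0 < eps.
Implicit Types (s : umst_state B) (G t y : evec B).

Lemma linearizationE y t : dom_h y -> linearization grad y t = dotv (grad y) t.
Proof.
move=> /dom_h_ge0 y0; rewrite /linearization dotvBr.
by rewrite (subdiff_Phi_homog _ _ _ _ (grad_subdiff _ y0)); ring.
Qed.

(* The gap is at most [<grad t - grad y, t - y>] by the subgradient inequality at
   [t]; Young's inequality then brings in [M]. *)
Lemma Phi_le_linearization y t L : dom_h y -> dom_h t -> 0 < L ->
  Phi t <= linearization grad y t + L / 2 * norm2 (t - y) ^+ 2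
           + M B ^+ 2 / (2 * L).
Proof.
move=> yd td L0; rewrite linearizationE//.
have y0 := dom_h_ge0 _ _ _ yd; have t0 := dom_h_ge0 _ _ _ td.
have sy := grad_subdiff _ y0; have st := grad_subdiff _ t0.
have gap : Phi t - dotv (grad y) t <= dotv (grad t - grad y) (t - y).
  rewrite dotvBl !dotvBr (subdiff_Phi_homog _ _ _ _ st).
  have := subdiff_Phi_le _ _ _ _ y st; have := subdiff_Phi_homog _ _ _ _ sy.
  lra.
have young := dotv_young _ _ (grad t - grad y) (t - y) _ L0.
have le_M : (2 * L)^-1 * norm2 (grad t - grad y) ^+ 2 <= M B ^+ 2 / (2 * L).
  rewrite mulrC ler_wpM2r ?invr_ge0 ?(mulr_ge0 _ (ltW L0))//.
  rewrite lerXn2r ?nnegrE ?sqrtr_ge0// ?mulr_ge0 ?sqrtr_ge0 ?total_demand_ge0//.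
  exact: (M_bound _ _ _ _ t0 y0 st sy).
lra.
Qed.

(** [G] is the weighted sum of the subgradients so far. [inv_cert] is the certificate carried by the
    induction; [inv_le] serves the comparison with [t*], and [inv_flow] bounds the flows [fhat]. *)
Record umst_inv s G : Prop := UmstInv {
  inv_L : 0 < st_L s;
  inv_A : 0 <= st_A s;
  inv_t : dom_h (st_t s);
  inv_phi : forall t, st_phi s t = model G (st_A s) t;
  inv_u : is_argmin (@dom_h R B) (model G (st_A s)) (st_u s);
  inv_cert : st_A s * Q (st_t s) <=
    model G (st_A s) (st_u s) + st_A s * (eps / 2);
  inv_le : forall t, dotv G t <= st_A s * Phi t;
  inv_flow : forall e, 0 <= - G e <= st_A s * total_demand B
}.

Lemma dom_h_mix (A a : R) (u t : evec B) : 0 <= A -> 0 < a ->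
  dom_h u -> dom_h t -> dom_h ((A + a)^-1 *: (a *: u + A *: t)).
Proof.
move=> A0 a0 ud td; have S0 : 0 < A + a by rewrite ltr_wpDl.
rewrite scalerDr !scalerA; apply: dom_h_conv => //.
- by apply: mulr_ge0; rewrite ?invr_ge0 ltW.
- by apply: mulr_ge0; rewrite ?invr_ge0// ltW.
- by rewrite -mulrDr [a + A]addrC mulVf ?gt_eqF.
Qed.

Lemma phi_step s G y (a : R) : umst_inv s G -> dom_h y ->
  (fun t => st_phi s t + a * (linearization grad y t + h t)) =
  model (G + a *: grad y) (st_A s + a).
Proof.
move=> sG yd; apply/funext => t; rewrite (inv_phi _ _ sG) linearizationE//.
by rewrite /model dotvDl dotvZl; ring.
Qed.

Section Trial.
Variables (s : umst_state B) (G : evec B) (L : R) (s' : umst_state B).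
Hypotheses (sG : umst_inv s G) (L0 : 0 < L) (tr : umst_trial grad s L s').

Lemma trial_alpha : st_alpha s' = stepsize L (st_A s).
Proof. by case: tr => -[]. Qed.

Lemma trial_alpha_gt0 : 0 < st_alpha s'.
Proof. by rewrite trial_alpha stepsize_gt0. Qed.

Lemma trial_A : st_A s' = st_A s + st_alpha s'.
Proof. by case: tr => -[]. Qed.

Lemma trial_A_gt0 : 0 < st_A s'.
Proof. by rewrite trial_A ltr_wpDl ?trial_alpha_gt0// (inv_A _ _ sG). Qed.

Lemma trial_AE : st_A s' = L * st_alpha s' ^+ 2.
Proof.
by rewrite trial_alpha (stepsize_eq _ _ _ L0 (inv_A _ _ sG)) -trial_alpha trial_A.
Qed.

Lemma trial_y : dom_h (st_y s').
Proof.
case: tr => _ [-> _ _ _]; rewrite trial_A.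
apply: dom_h_mix (inv_A _ _ sG) trial_alpha_gt0 _ (inv_t _ _ sG).
by case: (inv_u _ _ sG).
Qed.

Lemma trial_t : dom_h (st_t s').
Proof.
case: tr => _ [_ _ [ud _] ->]; rewrite trial_A.
exact: dom_h_mix (inv_A _ _ sG) trial_alpha_gt0 ud (inv_t _ _ sG).
Qed.

(** Since [A' = L * alpha ^+ 2], the accuracy slack equals [eps / (2 * L * alpha)], which then
    covers the error [M ^+ 2 / (2 * L)]. *)
Lemma trial_accept : st_alpha s' * M B ^+ 2 <= eps -> umst_accept grad eps s'.
Proof.
move=> small; rewrite /umst_accept.
have a0 := trial_alpha_gt0; have -> : st_L s' = L by case: tr => -[].
apply: le_trans (Phi_le_linearization _ _ _ trial_y trial_t L0) _.
rewrite lerD2l trial_AE.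
have -> : st_alpha s' / (2 * (L * st_alpha s' ^+ 2)) * eps =
    (eps / st_alpha s') / (2 * L) by field; rewrite !gt_eqF.
rewrite ler_wpM2r//; first by rewrite invr_ge0 mulr_ge0// ltW.
by rewrite ler_pdivlMr// mulrC.
Qed.

Lemma trial_phi :
  st_phi s' = model (G + st_alpha s' *: grad (st_y s')) (st_A s').
Proof.
by case: tr => _ [_ -> _ _]; rewrite (phi_step _ _ _ _ sG trial_y) -trial_A.
Qed.

Lemma trial_inv : umst_accept grad eps s' ->
  umst_inv s' (G + st_alpha s' *: grad (st_y s')).
Proof.
move=> acc; have a0 := trial_alpha_gt0; have A0 := inv_A _ _ sG.
have A'0 := trial_A_gt0; have yd := trial_y; have y0 := dom_h_ge0 _ _ _ yd.
have sy := grad_subdiff _ y0.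
have [_ [yE _ umin tE]] := tr; rewrite trial_phi in umin; have [u'd _] := umin.
split=> //.
- by have [[->]] := tr.
- exact: ltW.
- exact: trial_t.
- by move=> t; rewrite trial_phi.
- have [ud _] := inv_u _ _ sG; have td := inv_t _ _ sG.
  set g := grad (st_y s') in acc sy umin *.
  have growth := model_growth _ _ _ _ _ _ A0 (inv_u _ _ sG) u'd.
  pose l := st_alpha s' / st_A s'.
  have l01 : 0 <= l <= 1.
    apply/andP; split; first by apply: divr_ge0; exact: ltW.
    by rewrite ler_pdivrMr// mul1r trial_A lerDr.
  have lA : l * st_A s' = st_alpha s' by rewrite /l divfK ?gt_eqF.
  have l1A : (1 - l) * st_A s' = st_A s by rewrite mulrBl lA mul1r trial_A; lra.
  have t'E : st_t s' = (1 - l) *: st_t s + l *: st_u s'.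
    rewrite tE scalerDr !scalerA addrC; congr (_ *: _ + _ *: _).
      by rewrite -l1A mulrCA mulVf ?gt_eqF ?mulr1.
    by rewrite mulrC.
  (* [y^{k+1}] and [t^{k+1}] give [t^k] the same weight, so only the [u] parts differ. *)
  have tyE : norm2 (st_t s' - st_y s') ^+ 2 = l ^+ 2 * norm2 (st_u s' - st_u s) ^+ 2.
    rewrite -sqr_norm2Z; congr (norm2 _ ^+ 2).
    rewrite tE yE -scalerBr opprD addrACA subrr addr0 -scalerBr scalerA.
    by rewrite mulrC.
  have hconv := ler_wpM2l (ltW A'0) (h_convex _ _ _ _ _ l01 td u'd).
  rewrite -t'E in hconv.
  have accA := ler_wpM2l (ltW A'0) acc; rewrite linearizationE// tyE in accA.
  have LE : st_L s' = L by have [[->]] := tr.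
  have quadE : st_A s' * (st_L s' / 2 * (l ^+ 2 * norm2 (st_u s' - st_u s) ^+ 2))
      = 2^-1 * norm2 (st_u s' - st_u s) ^+ 2.
    rewrite LE /l; set D := norm2 _ ^+ 2.
    transitivity (L * st_alpha s' ^+ 2 / st_A s' * (2^-1 * D)).
      by field; rewrite gt_eqF.
    by rewrite -trial_AE divff ?gt_eqF// mul1r.
  have epsE : st_A s' * (st_alpha s' / (2 * st_A s') * eps) = st_alpha s' * (eps / 2).
    by field; rewrite gt_eqF.
  have dotE : st_A s' * dotv g (st_t s') =
      st_A s * dotv g (st_t s) + st_alpha s' * dotv g (st_u s').
    by rewrite t'E dotvDr !dotvZr -l1A -lA; ring.
  have hE : st_A s' * ((1 - l) * h (st_t s) + l * h (st_u s')) =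
      st_A s * h (st_t s) + st_alpha s' * h (st_u s').
    by rewrite -l1A -lA; ring.
  (* Replaces the linear form at [t^k] by [Phi], so that the old certificate applies; [growth] at
     [u^{k+1}] then pays for the quadratic term of [accA]. *)
  have lin := ler_wpM2l A0 (subdiff_Phi_le _ _ _ _ (st_t s) sy).
  have := inv_cert _ _ sG.
  move: accA hconv lin growth; rewrite !mulrDr quadE epsE dotE -mulrDr hE /model.
  rewrite dotvDl dotvZl /Q; have := trial_A; move: (st_A s') => A' ->.
  lra.
- move=> t; rewrite dotvDl dotvZl trial_A mulrDl lerD ?(inv_le _ _ sG)//.
  exact: (ler_wpM2l (ltW a0) (subdiff_Phi_le _ _ _ _ _ sy)).
- move=> e; rewrite !ffunE opprD; have /andP[G0 GD] := inv_flow _ _ sG e.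
  have /andP[g0 gD] := subdiff_Phi_flow _ _ _ _ e sy.
  rewrite -mulrN addr_ge0 ?(mulr_ge0 (ltW a0))//= trial_A mulrDl lerD//.
  exact: (ler_wpM2l (ltW a0) gD).
Qed.

End Trial.

Lemma trial_exists s G (L : R) : umst_inv s G -> 0 < L ->
  exists s', umst_trial grad s L s'.
Proof.
move=> sG L0; have A0 := inv_A _ _ sG; have [ud _] := inv_u _ _ sG.
set a := stepsize L (st_A s); have a0 : 0 < a := stepsize_gt0 _ _ _ L0.
set y := (st_A s + a)^-1 *: (a *: st_u s + st_A s *: st_t s).
have yd : dom_h y := dom_h_mix _ _ _ _ A0 a0 ud (inv_t _ _ sG).
have [u umin] := model_argmin _ _ (G + a *: grad y) _ (addr_ge0 A0 (ltW a0)).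
exists (UmstState L a (st_A s + a) y u
  ((st_A s + a)^-1 *: (a *: u + st_A s *: st_t s))
  (fun t => st_phi s t + a * (linearization grad y t + h t))).
by split; split=> //=; rewrite (phi_step _ _ _ _ sG yd); exact: umin.
Qed.

Lemma search_exists s G (L : R) : 0 < M B -> umst_inv s G -> 0 < L ->
  exists s', umst_search grad eps s L s'.
Proof.
move=> M0 sG L0; have A0 := inv_A _ _ sG.
pose c := eps / M B ^+ 2.
have c0 : 0 < c by rewrite divr_gt0// exprn_gt0.
(* [n] bounds the number of doublings still needed; acceptance may come earlier. *)
have bounded n K : 0 < K -> stepsize (2 ^+ n * K) (st_A s) <= c ->
    exists s', umst_search grad eps s K s'.
  elim: n K => [|n IHn] K K0 small; have [s' tr] := trial_exists _ _ _ sG K0.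
    exists s'; apply: UmstAccept => //; apply: (trial_accept _ _ _ _ sG K0 tr).
    rewrite (trial_alpha _ _ _ tr) -ler_pdivlMr ?exprn_gt0//.
    by rewrite expr0 mul1r in small.
  have [acc|nacc] := pselect (umst_accept grad eps s').
    by exists s'; exact: UmstAccept tr acc.
  have [||s'' ss''] := IHn (2 * K); first by rewrite mulr_gt0.
    by rewrite mulrA -exprSr.
  by exists s''; exact: UmstRetry tr nacc ss''.
(* Once [2 ^+ n >= x], [stepsize_le] puts the step for [2 ^+ n * L] below [c]; [n < 2 ^ n] makes any
   [n >= x] suffice. *)
pose x := (st_A s + c) / (L * c ^+ 2).
have Lc0 : 0 < L * c ^+ 2 by rewrite mulr_gt0// exprn_gt0.
have x0 : 0 <= x by apply: divr_ge0 (ltW Lc0); rewrite addr_ge0// ltW.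
apply: (bounded (Num.bound x)) => //.
apply: stepsize_le => //; first by rewrite mulr_gt0 ?exprn_gt0.
rewrite -mulrA -ler_pdivrMr// -/x; apply: le_trans (ltW (archi_boundP x0)) _.
by rewrite -natrX ler_nat ltnW// ltn_expl.
Qed.

(** Half of the threshold [eps / M ^+ 2] below which every trial is accepted. *)
Definition min_step : R := eps / (2 * M B ^+ 2).

(** A rejected step exceeds [eps / M ^+ 2], so its successor, at least half as large, stays above
    [min_step]. The next search starts with a smaller [L] and a larger [A], hence with no smaller
    step. *)
Lemma search_inv s G (L : R) s' : 0 < M B -> umst_inv s G -> 0 < L ->
  min_step <= stepsize L (st_A s) -> umst_search grad eps s L s' ->
  [/\ umst_inv s' (G + st_alpha s' *: grad (st_y s')),
      min_step <= st_alpha s',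
      st_A s' = st_A s + st_alpha s'
    & min_step <= stepsize (st_L s' / 2) (st_A s')].
Proof.
move=> M0 sG + + ss'.
elim: {L s'} ss' => [L s' tr acc|L s1 s2 tr nacc _ IH] L0 le_b.
  have a_b : min_step <= st_alpha s' by rewrite (trial_alpha _ _ _ tr).
  have A'E := trial_A _ _ _ tr; have s'G := trial_inv _ _ _ _ sG L0 tr acc.
  split=> //; apply: le_trans le_b _.
  have LE : st_L s' = L by case: tr => -[].
  rewrite LE; apply: stepsize_mono; rewrite ?divr_gt0//.
  - by rewrite ler_pdivrMr//; lra.
  - exact: inv_A sG.
  - by rewrite A'E lerDl ltW// (trial_alpha_gt0 _ _ _ L0 tr).
apply: IH; first by rewrite mulr_gt0.
have M20 : 0 < M B ^+ 2 by rewrite exprn_gt0.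
have big : eps < stepsize L (st_A s) * M B ^+ 2.
  rewrite ltNge; apply/negP => small; apply: nacc.
  by apply: (trial_accept _ _ _ _ sG L0 tr); rewrite (trial_alpha _ _ _ tr).
have dbl := stepsize_double _ _ _ L0 (inv_A _ _ sG).
rewrite /min_step ler_pdivrMr ?(mulr_gt0 _ M20)//.
by move: (ler_wpM2r (ltW M20) dbl); lra.
Qed.

(** * Complete runs *)

Section Run.
Variable L0 : R.
Hypotheses (L0_gt0 : 0 < L0) (L0_le : L0 <= 4 * M B ^+ 2 / eps).

Lemma M_gt0 : 0 < M B.
Proof.
have : 0 <= M B by rewrite mulr_ge0 ?sqrtr_ge0 ?total_demand_ge0.
rewrite le_eqVlt => /predU1P[M0|//]; move: (lt_le_trans L0_gt0 L0_le).
by rewrite -M0 expr0n mulr0 mul0r ltxx.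
Qed.

Lemma init_inv s : umst_init L0 s ->
  umst_inv s 0 /\ min_step <= stepsize (st_L s / 2) (st_A s).
Proof.
move=> [LE AE uE tE phiE]; split.
  have dotv0 t : dotv (0 : evec B) t = 0.
    by rewrite /dotv big1// => e _; rewrite ffunE mul0r.
  have modelE t : model 0 (st_A s) t = 2^-1 * norm2 (t - free_time B) ^+ 2.
    by rewrite /model dotv0 AE mul0r !addr0.
  have model_ge0 t : 0 <= model 0 (st_A s) t.
    by rewrite modelE mulr_ge0 ?sqr_ge0// invr_ge0.
  split=> //; rewrite ?LE ?AE ?tE ?phiE//.
  - by move=> t; rewrite -AE modelE.
  - rewrite -AE uE; split=> [e|t _]; first by rewrite lexx.
    apply: le_trans (model_ge0 t); rewrite modelE sqr_norm2 big1 ?mulr0// => e _.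
    by rewrite subrr ffunE expr0n.
  - by rewrite !mul0r addr0 -[X in model _ X]AE.
  - by move=> t; rewrite dotv0 mul0r.
  - by move=> e; rewrite ffunE oppr0 mul0r lexx.
have L2 : 0 < L0 / 2 by rewrite divr_gt0.
rewrite LE AE; have a0 := stepsize_gt0 _ _ 0 L2.
have := stepsize_eq _ _ _ L2 (lexx 0); set a := stepsize _ _ in a0 *.
rewrite add0r => aE.
(* With [A_0 = 0] the quadratic reduces to [L0 / 2 * a ^+ 2 = a]; [min_step <= 2 / L0] is then a
   rewriting of [L0_le]. *)
have {}aE : a = 2 / L0.
  apply: (mulfI (lt0r_neq0 L2)); apply: (mulIf (lt0r_neq0 a0)).
  by rewrite -mulrA -expr2 aE; field; rewrite gt_eqF.
have M20 : 0 < M B ^+ 2 by rewrite exprn_gt0// M_gt0.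
rewrite aE /min_step ler_pdivrMr ?(mulr_gt0 _ M20)// mulrAC ler_pdivlMr//.
by move: L0_le; rewrite ler_pdivlMr// mulrC; lra.
Qed.

Lemma run_exists : exists s : nat -> umst_state B, umst_run grad L0 eps s.
Proof.
pose good s := exists G, umst_inv s G /\ min_step <= stepsize (st_L s / 2) (st_A s).
have /choice[f fP] : forall s, exists s', good s ->
    umst_search grad eps s (st_L s / 2) s' /\ good s'.
  (* Outside [good] states the claim is vacuous and the successor is arbitrary. *)
  move=> s; have [[G [sG bs]]|nG] := pselect (good s); last by exists s.
  have L2 : 0 < st_L s / 2 by rewrite divr_gt0// (inv_L _ _ sG).
  have [s' ss'] := search_exists _ _ _ M_gt0 sG L2.
  have [s'G _ _ bs'] := search_inv _ _ _ _ M_gt0 sG L2 bs ss'.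
  by exists s' => _; split=> //; exists (G + st_alpha s' *: grad (st_y s')).
pose s0 := UmstState L0 0 0 0 (free_time B) (free_time B)
  (fun t => 2^-1 * norm2 (t - free_time B) ^+ 2).
have s0_init : umst_init L0 s0 by [].
have good_iter n : good (iter n f s0).
  elim: n => [|n IHn]; last by have [] := fP _ IHn.
  by exists 0; exact: init_inv.
exists (fun n => iter n f s0); split=> // n.
by have [] := fP _ (good_iter n).
Qed.

Variables (s : nat -> umst_state B).
Hypothesis s_run : umst_run grad L0 eps s.

Definition grad_sum N : evec B :=
  \sum_(1 <= k < N.+1) st_alpha (s k) *: grad (st_y (s k)).

Lemma run_inv N : [/\ umst_inv (s N) (grad_sum N),
  min_step <= stepsize (st_L (s N) / 2) (st_A (s N))
  & N%:R * min_step <= st_A (s N)].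
Proof.
have [init step] := s_run; elim: N => [|N [sG bs le_A]].
  have [sG bs] := init_inv _ init; rewrite /grad_sum big_geq//; split=> //.
  by rewrite mul0r (inv_A _ _ sG).
have L2 : 0 < st_L (s N) / 2 by rewrite divr_gt0// (inv_L _ _ sG).
have [s'G a_b AE bs'] := search_inv _ _ _ _ M_gt0 sG L2 bs (step N).
rewrite /grad_sum big_nat_recr//=; split=> //.
by rewrite AE -natr1 mulrDl mul1r lerD.
Qed.

(** Shared by both claims: [t] is the comparison point and [Z] is [Q tstar] or [- Psi fhat]. The
    certificate at [t] gives [A * (Q - Z) <= r ^+ 2 / 2 + A * eps / 2], and [r ^+ 2 <= A * eps]. *)
Lemma run_gap N (t : evec B) (r Z : R) : (1 <= N)%N -> dom_h t ->
  norm2 (t - free_time B) ^+ 2 <= r ^+ 2 ->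
  4 * (r * M B / eps) ^+ 2 <= N%:R ->
  dotv (grad_sum N) t + st_A (s N) * h t <= st_A (s N) * Z ->
  Q (st_t (s N)) - Z <= eps.
Proof.
move=> N0 td t_r r_N GZ; have [sG _ le_A] := run_inv N; have M0 := M_gt0.
have b0 : 0 < min_step by rewrite divr_gt0// (mulr_gt0 _ (exprn_gt0 _ M0)).
have A0 : 0 < st_A (s N) by rewrite (lt_le_trans _ le_A)// mulr_gt0// ltr0n.
have r_A : r ^+ 2 <= st_A (s N) * eps.
  have := ler_wpM2r (ltW b0) r_N => /le_trans/(_ le_A)/(ler_wpM2r (ltW eps_gt0)).
  apply: le_trans.
  (* Multiplying the iteration count by [min_step * eps] yields [2 * r ^+ 2], which dominates
     [r ^+ 2]. *)
  have -> : 4 * (r * M B / eps) ^+ 2 * min_step * eps = 2 * r ^+ 2.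
    by rewrite /min_step; field; rewrite !gt_eqF.
  by rewrite ler_peMl ?sqr_ge0// ler1n.
have [_ /(_ t td) u_min] := inv_u _ _ sG.
rewrite -(ler_pM2l A0) mulrBr.
have := inv_cert _ _ sG; move: u_min; rewrite {2}/model; lra.
Qed.

End Run.

End Method.

(** * Iteration counts and the two claims *)

(** The largest admissible index, [max 1 (ceil K)], serves as witness. *)
Lemma holds_within_ge (R : realType) (K : R) (P : nat -> Prop) :
  (forall N : nat, (1 <= N)%N -> K <= N%:R -> P N) -> holds_within K P.
Proof.
move=> KP; pose m := Num.max 1 (Num.ceil K).
have m1 : 1 <= m by rewrite le_max lexx.
have mE : (`|m|%N)%:Z = m by rewrite gez0_abs// (le_trans _ m1).
have N1 : (1 <= `|m|)%N by rewrite -lez_nat mE.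
exists `|m|%N; split=> //; first by rewrite mE.
apply: KP => //; apply: le_trans (ceil_ge K) _.
by rewrite -[_%:R]/((`|m|%N)%:Z%:~R) mE ler_int le_max lexx orbT.
Qed.

Theorem theorem3p7 (R : realType) (B : beckmann R)
    (* the subgradient oracle used by the method *)
    (grad : evec B -> evec B)
    (grad_subdiff : forall t, lev 0 t -> subdiff_Phi t (grad t))
    (* the bound that comes with the constant M *)
    (M_bound : forall t1 t2 g1 g2 : evec B, lev 0 t1 -> lev 0 t2 ->
       subdiff_Phi t1 g1 -> subdiff_Phi t2 g2 -> norm2 (g1 - g2) <= M B)
    (tstar : evec B)
    (tstar_min : is_argmin (@dom_h R B) (@Q R B) tstar)
    (L0 eps : R) (eps_gt0 : 0 < eps)
    (L0_gt0 : 0 < L0) (L0_le : L0 <= 4 * M B ^+ 2 / eps) :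
  (* the method is well defined: minimizers exist, inner loops terminate *)
  (exists s : nat -> umst_state B, umst_run grad L0 eps s) /\
  (forall s : nat -> umst_state B, umst_run grad L0 eps s ->
     holds_within (4 * (norm2 (tstar - free_time B) * M B / eps) ^+ 2)
       (fun N => Q (st_t (s N)) - Q tstar <= eps) /\
     holds_within (4 * (Rtilde B * M B / eps) ^+ 2)
       (fun N => Q (st_t (s N)) + Psi (fhat grad s N) <= eps)).
Proof.
split; first exact: (run_exists R B grad grad_subdiff M_bound eps eps_gt0 L0).
move=> s s_run.
have inv N := run_inv R B grad grad_subdiff M_bound eps eps_gt0 L0 L0_gt0 L0_le
  s s_run N.
have gap N t r Z N1 := run_gap R B grad grad_subdiff M_bound eps eps_gt0 L0
  L0_gt0 L0_le s s_run N t r Z N1.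
split; apply: holds_within_ge => N N1 leN.
  have [sG _ _] := inv N; have [td _] := tstar_min.
  apply: gap N1 td (lexx _) leN _.
  by rewrite mulrDr lerD2r (inv_le _ _ _ _ _ sG).
have [sG b_step le_A] := inv N.
have M0 := M_gt0 R B eps L0 L0_gt0 L0_le.
have A0 : 0 < st_A (s N).
  apply: lt_le_trans le_A; apply: mulr_gt0; first by rewrite ltr0n.
  by rewrite divr_gt0// (mulr_gt0 _ (exprn_gt0 _ M0)).
set f := fhat grad s N.
have fE e : f e = (st_A (s N))^-1 * - grad_sum R B grad s N e.
  by rewrite /f /fhat !ffunE mulrN.
have f_flow e : 0 <= f e <= total_demand B.
  have /andP[G0 GD] := inv_flow _ _ _ _ _ sG e.
  rewrite fE mulr_ge0 ?invr_ge0 ?(ltW A0)//=.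
  by rewrite mulrC ler_pdivrMr// mulrC.
(* Taken with [t = edge_costs f] and [Z = - Psi f]: as [grad_sum = - A *: f], conjugacy turns the
   last premise of [run_gap] into an equality. *)
rewrite -[Psi f]opprK; apply: gap N1 (dom_h_edge_costs _ _ f)
  (edge_costs_le_Rtilde _ _ f f_flow) leN _.
rewrite Psi_conjugate; last by move=> e; case/andP: (f_flow e).
have -> : grad_sum R B grad s N = - st_A (s N) *: f.
  apply/ffunP => e; rewrite ffunE fE /GRing.scale/=.
  by field; rewrite gt_eqF.
by rewrite dotvZl; lra.
Qed.
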